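(* In the setting of the context, let $u\in\mathcal B_R$ and suppose that there is an index $k\in\mathbb N$ and a positive constant $c(u,k)$ such that for any $v\in\mathcal B_R$, $$\max_{0\le i\le k}\|\Phi_{t_i}(u)-\Phi_{t_i}(v)\|\ge c(u,k)\|v-u\|.$$ For $\epsilon>0$ let $$\Lambda_k^{(\epsilon)}=\left\{v\in\mathcal B_R:\max_{0\le i\le k}\|Y_i-\Phi_{t_i}(v)\|\le\epsilon\right\},\qquad \Omega_k^{(\epsilon)}=\left\{v\in\mathcal B_R:\max_{0\le i\le k}\|\Phi_{t_i}(v)-\Phi_{t_i}(u)\|\le\epsilon\right\}.$$ Then for any $\epsilon>0$, $$\mathrm{diam}\big(\Omega_k^{(\epsilon)}\big)\le c(u,k)\,\epsilon,\quad\text{and thus, for $\epsilon$-bounded observation errors,}\quad \mathrm{diam}\big(\Lambda_k^{(\epsilon)}\big)\le 2c(u,k)\,\epsilon.$$ Thus for $\epsilon$-bounded observation errors ($\|Z_i\|\le\epsilon$ almost surely for every $i\in\mathbb N$), the support of the smoother is bounded as $$\mathrm{diam}\,\mathrm{supp}\,\mu^{\mathrm{sm}}(\cdot|Y_0,\ldots,Y_k)\le 2c(u,k)\,\epsilon,$$ and the support of the filter is bounded as $$\mathrm{diam}\,\mathrm{supp}\,\mu^{\mathrm{fi}}(\cdot|Y_0,\ldots,Y_k)\le 2c(u,k)\,e^{Gt_k}\,\epsilon,$$ where $G=\|A\|+2\|B\|R$.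
   Context: Dynamics: $\frac{du}{dt}=-Au-B(u,u)+f$ on $\mathbb R^d$, with $A$ a linear operator, $B:\mathbb R^d\times\mathbb R^d\to\mathbb R^d$ bilinear, $f\in\mathbb R^d$. For $v\in\mathbb R^d$, $v(t)=\Psi_t(v)$ is the solution with $v(0)=v$. Trapping ball assumption: there are $R,\delta>0$ with $\langle -Av-B(v,v)+f,v\rangle\le0$ whenever $\|v\|\in[R,R+\delta]$. $\mathcal B_R=\{v:\|v\|\le R\}$; for $v\in\mathcal B_R$ the solution exists for all $t\ge0$ and stays in $\mathcal B_R$, and $\Psi_t$ is one-to-one from $\mathcal B_R$ onto $\Psi_t(\mathcal B_R)$ with inverse denoted $\Psi_{-t}$. $\|A\|$ is the Euclidean operator norm and $\|B\|=\sup_{\|v\|=\|w\|=1}\|B(v,w)\|$. Observations: $t_i=ih$ with fixed $h>0$, $Y_i=Hu(t_i)+Z_i$, $H\in\mathbb R^{d_o\times d}$, $Z_i$ i.i.d. centered with density $\eta$, true initial point $u$. $\Phi_t(v):=H\Psi_t(v)$. The prior $q$ is a probability density on $\mathbb R^d$ vanishing outside $\mathcal B_R$. The smoothing density is $\mu^{\mathrm{sm}}(v|Y_0,\ldots,Y_k)\propto q(v)\prod_{i=0}^k\eta(Y_i-H\Psi_{t_i}(v))$ for $v\in\mathcal B_R$, and $0$ otherwise. The filtering density is $\mu^{\mathrm{fi}}(v|Y_0,\ldots,Y_k)\propto\left[\prod_{i=0}^k\eta(Y_i-H\Psi_{t_i-t_k}(v))\right]\det(J\Psi_{-t_k}(v))\,q(\Psi_{-t_k}(v))$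 for $v\in\Psi_{t_k}(\mathcal B_R)$ ($J$ the Jacobian matrix, $\Psi_{t_i-t_k}(v)=\Psi_{t_i}(\Psi_{-t_k}(v))$), and $0$ otherwise. The support of either is the set of points where the density is nonzero.
   Formalization: The bounds have 2/c(u,k) in place of c(u,k), since the printed ones fail (e.g. identity flow, H=1, u=0, k=0, c=1/4); for the smoother and filter supports, the noise density η is taken to be a version vanishing outside the ε-ball. *)

(* Defs.v *)
(* MathComp-Analysis, over an arbitrary realType. *)
From HB Require Import structures.
From mathcomp Require Import all_boot all_order all_algebra.
From mathcomp Require Import all_classical all_reals all_analysis.
Set Implicit Arguments.
Unset Strict Implicit.
Unset Printing Implicit Defensive.
Import Order.TTheory GRing.Theory Num.Theory numFieldNormedType.Exports.
Local Open Scope classical_set_scope.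
Local Open Scope ring_scope.

(* Vectors of R^n are row vectors. The library norm `|v| on 'rV[R]_n is the
   sup norm, so the Euclidean norm and inner product are introduced here. *)
Definition dotp (R : realType) (n : nat) (v w : 'rV[R]_n) : R :=
  \sum_(i < n) v 0 i * w 0 i.

Definition enorm (R : realType) (n : nat) (v : 'rV[R]_n) : R :=
  Num.sqrt (dotp v v).

Definition eball (R : realType) (n : nat) (r : R) : set 'rV[R]_n :=
  [set v | enorm v <= r].

(* The convention is diam set0 = 0. *)
Definition diam (R : realType) (n : nat) (S : set 'rV[R]_n) : \bar R :=
  maxe 0%E (ereal_sup [set x | exists v w, [/\ S v, S w &
                                             x = (enorm (v - w))%:E]]).

Definition op_norm (R : realType) (n : nat)
    (A : {linear 'rV[R]_n -> 'rV[R]_n}) : R :=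
  sup [set x | exists2 v, enorm v = 1 & x = enorm (A v)].

Definition bilin_norm (R : realType) (n : nat)
    (B : {bilinear 'rV[R]_n -> 'rV[R]_n -> 'rV[R]_n}) : R :=
  sup [set x | exists v w, [/\ enorm v = 1, enorm w = 1 &
                              x = enorm (B v w)]].

Definition vfield (R : realType) (n : nat)
    (A : {linear 'rV[R]_n -> 'rV[R]_n})
    (B : {bilinear 'rV[R]_n -> 'rV[R]_n -> 'rV[R]_n})
    (f v : 'rV[R]_n) : 'rV[R]_n :=
  - A v - B v v + f.

(* x solves x' = F x, x 0 = v, on an open interval containing 0 and t
   (t may be negative). For a smooth F, a solution on the closed interval
   between 0 and t always extends to such an open interval. *)
Definition solution_upto (R : realType) (n : nat) (F : 'rV[R]_n -> 'rV[R]_n)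
    (v : 'rV[R]_n) (t : R) (x : R -> 'rV[R]_n) : Prop :=
  exists a b : R, [/\ a < 0 < b, a < t < b, x 0 = v &
    forall s : R, a < s < b -> is_derive s 1 x (F (x s))].

(* The value at time t of the solution started from v (0 if there is none).
   Negative times follow the solution backwards, so that flow F (- t) inverts
   flow F t; it is the true backward solution on a neighbourhood of
   flow F t @` eball r and hence has a Jacobian matrix at each of its points. *)
Definition flow (R : realType) (n : nat) (F : 'rV[R]_n -> 'rV[R]_n)
    (t : R) (v : 'rV[R]_n) : 'rV[R]_n :=
  xget 0 [set y | exists2 x, solution_upto F v t x & x t = y].

Definition obs (R : realType) (n m : nat) (F : 'rV[R]_n -> 'rV[R]_n)
    (H : 'M[R]_(m, n)) (t : R) (v : 'rV[R]_n) : 'rV[R]_m :=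
  flow F t v *m H^T.

(* Measure theory on R^n goes through the library's product sigma-algebra on
   n.-tuple R, i.e. the Borel sigma-algebra. *)
Definition row_of (R : realType) (n : nat)
    (t : n.-tuple (measurableTypeR R)) : 'rV[R]_n :=
  \row_j tnth t j.

Definition tuple_of_row (R : realType) (n : nat) (v : 'rV[R]_n) :
    n.-tuple (measurableTypeR R) :=
  [tuple v 0 j | j < n].

Fixpoint lebesgue_tuple (R : realType) (n : nat) :
    set (n.-tuple (measurableTypeR R)) -> \bar R :=
  match n with
  | 0 => dirac [tuple]
  | n'.+1 => pushforward (lebesgue_measure \x @lebesgue_tuple R n')%E
               (fun p => [tuple of p.1 :: p.2])
  end.

Definition is_density (R : realType) (n : nat) (g : 'rV[R]_n -> R) : Prop :=
  [/\ forall v, 0 <= g v,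
      measurable_fun setT (g \o @row_of R n) &
      (\int[@lebesgue_tuple R n]_t (g (row_of t))%:E = 1)%E].

Definition random_vector (R : realType) (n : nat) (dT : measure_display)
    (T : measurableType dT) (X : T -> 'rV[R]_n) : Prop :=
  measurable_fun setT (@tuple_of_row R n \o X).

Definition has_density (R : realType) (n : nat) (dT : measure_display)
    (T : measurableType dT) (P : probability T R) (X : T -> 'rV[R]_n)
    (g : 'rV[R]_n -> R) : Prop :=
  forall S : set (n.-tuple (measurableTypeR R)), measurable S ->
    P ((@tuple_of_row R n \o X) @^-1` S) =
    (\int[@lebesgue_tuple R n]_(t in S) (g (row_of t))%:E)%E.

Definition independent_vectors (R : realType) (n : nat) (dT : measure_display)
    (T : measurableType dT) (P : probability T R) (X : nat -> T -> 'rV[R]_n) :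
    Prop :=
  forall (s : seq nat) (S : nat -> set (n.-tuple (measurableTypeR R))),
    uniq s -> (forall i, measurable (S i)) ->
    P (\bigcap_(i in [set` s]) ((@tuple_of_row R n \o X i) @^-1` S i)) =
    (\prod_(i <- s) P ((@tuple_of_row R n \o X i) @^-1` S i))%E.

Definition centered (R : realType) (n : nat) (dT : measure_display)
    (T : measurableType dT) (P : probability T R) (X : T -> 'rV[R]_n) : Prop :=
  forall j : 'I_n, P.-integrable setT (EFin \o (fun w => X w 0 j)) /\
    expectation P (fun w => X w 0 j) = 0%E.

(* The density proportional to w. *)
Definition normalize (R : realType) (n : nat) (w : 'rV[R]_n -> R)
    (v : 'rV[R]_n) : R :=
  w v / fine (\int[@lebesgue_tuple R n]_t (w (row_of t))%:E)%E.

Definition supp (R : realType) (n : nat) (g : 'rV[R]_n -> R) : set 'rV[R]_n :=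
  [set v | g v != 0].

(* Observation times are t_i = i * h. *)
Definition obs_gap (R : realType) (n m : nat) (F : 'rV[R]_n -> 'rV[R]_n)
    (H : 'M[R]_(m, n)) (h : R) (k : nat) (y : nat -> 'rV[R]_m)
    (v : 'rV[R]_n) : R :=
  \big[Num.max/0]_(i < k.+1) enorm (y i - obs F H (i%:R * h) v).

Definition Lambda (R : realType) (n m : nat) (F : 'rV[R]_n -> 'rV[R]_n)
    (H : 'M[R]_(m, n)) (h r : R) (k : nat) (y : nat -> 'rV[R]_m) (eps : R) :
    set 'rV[R]_n :=
  [set v | eball r v /\ obs_gap F H h k y v <= eps].

Definition Omega (R : realType) (n m : nat) (F : 'rV[R]_n -> 'rV[R]_n)
    (H : 'M[R]_(m, n)) (h r : R) (k : nat) (u : 'rV[R]_n) (eps : R) :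
    set 'rV[R]_n :=
  [set v | eball r v /\
    \big[Num.max/0]_(i < k.+1)
      enorm (obs F H (i%:R * h) v - obs F H (i%:R * h) u) <= eps].

Definition smoother (R : realType) (n m : nat) (F : 'rV[R]_n -> 'rV[R]_n)
    (H : 'M[R]_(m, n)) (h r : R) (q : 'rV[R]_n -> R) (eta : 'rV[R]_m -> R)
    (k : nat) (y : nat -> 'rV[R]_m) : 'rV[R]_n -> R :=
  normalize (fun v => if v \in @eball R n r then
    q v * \prod_(i < k.+1) eta (y i - obs F H (i%:R * h) v)
  else 0).

Definition filter_density (R : realType) (n m : nat)
    (F : 'rV[R]_n -> 'rV[R]_n) (H : 'M[R]_(m, n)) (h r : R)
    (q : 'rV[R]_n -> R) (eta : 'rV[R]_m -> R) (k : nat)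
    (y : nat -> 'rV[R]_m) : 'rV[R]_n -> R :=
  let back := flow F (- (k%:R * h)) in
  normalize (fun v => if v \in flow F (k%:R * h) @` @eball R n r then
    (\prod_(i < k.+1) eta (y i - obs F H (i%:R * h) (back v))) *
    \det (jacobian back v) * q (back v)
  else 0).

(* Main.v *)
Require Import Defs.
From HB Require Import structures.
From mathcomp Require Import all_boot all_order all_algebra.
From mathcomp Require Import all_classical all_reals all_analysis.
From mathcomp Require Import ring lra.
Import Order.TTheory GRing.Theory Num.Theory numFieldNormedType.Exports.
Local Open Scope classical_set_scope.
Local Open Scope ring_scope.

(** Identifiability turns closeness of the observed trajectories into closeness
    of the initial points: if the observations of [v] and [u] differ by at most
    [e], then [v] is within [e / c] of [u] ([obs_close_enorm_le]), and the
    triangle inequality through [u] doubles this to a bound on a diameter. For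
    Omega one takes [e = eps]. For Lambda, an error bounded by [eps] has to be
    added to the residual bounded by [eps], so [e = 2 * eps]
    ([Lambda_enorm_le]). Since the noise density vanishes outside the ball of
    radius [eps], the smoother is nonzero only at points of Lambda.

    For the filter, let [t] be the last observation time. A point [v] of the
    support is the value at time [t] of a solution started in the ball, and
    following that solution backwards shows that [flow (- t) v] is the start of
    some solution which reaches [v] at time [t] ([flow_back_solution]). The
    prior and the likelihood are evaluated at [flow (- t) v] and both are
    nonzero there, so this point lies in Lambda. It remains to compare two
    solutions started in the ball ([solution_lipschitz]). The trapping
    condition keeps both in the ball ([solution_eball]), where the bilinear
    structure gives a one-sided Lipschitz bound with constant [G] for the vector
    field ([vfield_one_sided_lipschitz]); Gronwall's inequality for the squared
    distance then yields the factor [exp (G t)]. *)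

(** * Euclidean geometry of row vectors *)

Section Euclid.
Context {R : realType} {n : nat}.
Implicit Types v w z : 'rV[R]_n.

Lemma dotpC v w : dotp v w = dotp w v.
Proof. by apply: eq_bigr => i _; rewrite mulrC. Qed.

Lemma dotpDl v w z : dotp (v + w) z = dotp v z + dotp w z.
Proof. by rewrite -big_split/=; apply: eq_bigr => i _; rewrite mxE mulrDl. Qed.

Lemma dotpZl a v w : dotp (a *: v) w = a * dotp v w.
Proof. by rewrite mulr_sumr; apply: eq_bigr => i _; rewrite mxE mulrA. Qed.

Lemma dotpDr v w z : dotp z (v + w) = dotp z v + dotp z w.
Proof. by rewrite dotpC dotpDl !(dotpC z). Qed.

Lemma dotpZr a v w : dotp w (a *: v) = a * dotp w v.
Proof. by rewrite dotpC dotpZl dotpC. Qed.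

Lemma dotp_ge0 v : 0 <= dotp v v.
Proof. by apply: sumr_ge0 => i _; rewrite -expr2 sqr_ge0. Qed.

Lemma dotp_eq0 {v} : dotp v v = 0 -> v = 0.
Proof.
move=> /eqP; rewrite psumr_eq0; last by move=> i _; rewrite -expr2 sqr_ge0.
move=> /allP v0; apply/rowP => i; rewrite mxE.
by have := v0 i (mem_index_enum _); rewrite mulf_eq0 orbb => /eqP.
Qed.

Lemma enorm_ge0 v : 0 <= enorm v.
Proof. exact: sqrtr_ge0. Qed.

Lemma enorm_sqr v : enorm v ^+ 2 = dotp v v.
Proof. exact/sqr_sqrtr/dotp_ge0. Qed.

Lemma enorm_eq0 {v} : enorm v = 0 -> v = 0.
Proof. by move=> v0; apply: dotp_eq0; rewrite -enorm_sqr v0 expr0n. Qed.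

Lemma enorm0 : enorm (0 : 'rV[R]_n) = 0.
Proof. by rewrite /enorm -(scale0r 0) dotpZl mul0r sqrtr0. Qed.

Lemma enormZ a v : enorm (a *: v) = `|a| * enorm v.
Proof.
by rewrite /enorm dotpZl dotpZr mulrA -expr2 sqrtrM ?sqr_ge0// sqrtr_sqr.
Qed.

Lemma enormB v w : enorm (v - w) = enorm (w - v).
Proof. by rewrite -opprB -scaleN1r enormZ normrN1 mul1r. Qed.

(** Cauchy-Schwarz, from the nonnegativity of the square norm of
    [<w,w> v - <v,w> w]. *)
Lemma dotp_le_enorm v w : dotp v w <= enorm v * enorm w.
Proof.
rewrite (le_trans (ler_norm _))// -(ler_pXn2r (n := 2)) ?nnegrE//; last first.
  by rewrite mulr_ge0 ?enorm_ge0.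
rewrite real_normK ?num_real// exprMn !enorm_sqr.
have [w0|wn0] := eqVneq (dotp w w) 0.
  by rewrite (dotp_eq0 w0) -(scale0r 0) !dotpZr !mul0r mulr0 expr0n.
have w_gt0 : 0 < dotp w w by rewrite lt_neqAle eq_sym wn0 dotp_ge0.
have := dotp_ge0 (dotp w w *: v - dotp v w *: w).
rewrite -scaleNr !(dotpDl, dotpDr, dotpZl, dotpZr) (dotpC w v).
rewrite (_ : _ + _ = dotp w w * (dotp v v * dotp w w - dotp v w ^+ 2)).
  by rewrite pmulr_rge0// subr_ge0.
by ring.
Qed.

Lemma enormD v w : enorm (v + w) <= enorm v + enorm w.
Proof.
rewrite -(ler_pXn2r (n := 2)) ?nnegrE ?addr_ge0 ?enorm_ge0//.
rewrite sqrrD !enorm_sqr dotpDl !dotpDr (dotpC w v).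
by have := dotp_le_enorm v w; lra.
Qed.

Lemma enorm_triangle v w z : enorm (v - w) <= enorm (v - z) + enorm (w - z).
Proof. by rewrite (enormB w z) -[v - w](subrKA z) enormD. Qed.

Lemma enorm_sum I (s : seq I) (x : I -> 'rV[R]_n) :
  enorm (\sum_(i <- s) x i) <= \sum_(i <- s) enorm (x i).
Proof.
elim/big_ind2: _ => [|a v b w va wb|//]; first by rewrite enorm0.
by rewrite (le_trans (enormD _ _))// lerD.
Qed.

Lemma normr_coord_le v i : `|v 0 i| <= enorm v.
Proof.
rewrite -(ler_pXn2r (n := 2)) ?nnegrE ?enorm_ge0// enorm_sqr.
rewrite real_normK ?num_real// /dotp (bigD1 i)//= expr2 lerDl.
by apply: sumr_ge0 => j _; rewrite -expr2 sqr_ge0.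
Qed.

Lemma enorm_normalize v : v != 0 -> enorm ((enorm v)^-1 *: v) = 1.
Proof.
move=> v0; have ev0 : enorm v != 0.
  by apply: contra_neq v0; exact: enorm_eq0.
by rewrite enormZ ger0_norm ?invr_ge0 ?enorm_ge0// mulVf.
Qed.

Lemma enorm_normK v : v = enorm v *: ((enorm v)^-1 *: v).
Proof.
have [->|v0] := eqVneq v 0; first by rewrite !scaler0.
rewrite scalerA mulfV ?scale1r//.
by apply: contra_neq v0; exact: enorm_eq0.
Qed.

End Euclid.

(** * Operator norms *)

Section OperatorNorms.
Context {R : realType} {n : nat}.
Variables (A : {linear 'rV[R]_n -> 'rV[R]_n}).
Variables (B : {bilinear 'rV[R]_n -> 'rV[R]_n -> 'rV[R]_n}).
Implicit Types v w : 'rV[R]_n.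

(** The suprema defining the operator norms are finite because a unit vector has
    coordinates of modulus at most 1, so the images of the basis vectors give a
    bound. *)
Lemma linear_enorm_sum (L : {linear 'rV[R]_n -> 'rV[R]_n}) {v} : enorm v = 1 ->
  enorm (L v) <= \sum_i enorm (L (delta_mx 0 i)).
Proof.
move=> v1; rewrite [in leLHS](row_sum_delta v) linear_sum.
rewrite (le_trans (enorm_sum _ _ _))//; apply: ler_sum => i _.
by rewrite linearZ enormZ ler_piMl ?enorm_ge0// -v1 normr_coord_le.
Qed.

Lemma bilinear_enorm_sum {v w} : enorm v = 1 -> enorm w = 1 ->
  enorm (B v w) <= \sum_j \sum_i enorm (B (delta_mx 0 i) (delta_mx 0 j)).
Proof.
move=> v1 w1; apply: le_trans (linear_enorm_sum (B v) w1) _.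
by apply: ler_sum => j _; exact: (linear_enorm_sum (applyr B (delta_mx 0 j)) v1).
Qed.

Lemma enorm_op_norm v : enorm (A v) <= op_norm A * enorm v.
Proof.
have [->|v0] := eqVneq v 0; first by rewrite linear0 enorm0 mulr0.
rewrite [in leLHS](enorm_normK v) linearZ enormZ ger0_norm ?enorm_ge0//.
rewrite mulrC ler_wpM2r ?enorm_ge0//; apply: ub_le_sup.
  exists (\sum_i enorm (A (delta_mx 0 i))) => _ [w w1 ->].
  exact: linear_enorm_sum.
by exists ((enorm v)^-1 *: v) => //; exact: enorm_normalize.
Qed.

Lemma bilin_norm_ub : has_ubound [set x | exists v w,
  [/\ enorm v = 1, enorm w = 1 & x = enorm (B v w)]].
Proof.
exists (\sum_j \sum_i enorm (B (delta_mx 0 i) (delta_mx 0 j))).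
by move=> _ [v [w [v1 w1 ->]]]; exact: bilinear_enorm_sum.
Qed.

(** When there is no unit vector (dimension 0) the supremum is that of the empty
    set, which is 0 by convention. *)
Lemma bilin_norm_ge0 : 0 <= bilin_norm B.
Proof.
rewrite /bilin_norm; set S := (X in sup X).
have [->|/set0P[x Sx]] := eqVneq S set0; first by rewrite sup0.
apply: le_trans (ub_le_sup bilin_norm_ub Sx).
by case: Sx => v [w [_ _ ->]]; exact: enorm_ge0.
Qed.

Lemma enorm_bilin_norm v w : enorm (B v w) <= bilin_norm B * (enorm v * enorm w).
Proof.
have [->|v0] := eqVneq v 0; first by rewrite linear0l !enorm0 mul0r mulr0.
have [->|w0] := eqVneq w 0; first by rewrite linear0r !enorm0 !mulr0.
rewrite [in leLHS](enorm_normK v) [in leLHS](enorm_normK w).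
rewrite linearZl_LR linearZr_LR !enormZ !ger0_norm ?enorm_ge0//.
rewrite mulrA mulrC ler_wpM2r ?mulr_ge0 ?enorm_ge0//.
apply: (ub_le_sup bilin_norm_ub).
by do 2 eexists; split; last reflexivity; exact: enorm_normalize.
Qed.

End OperatorNorms.

(** * Differential inequalities on an interval *)

Section Calculus.
Context {R : realType}.
Implicit Types (phi dphi : R -> R) (a b s L : R).

Lemma le0_is_derive_le phi dphi a b : a <= b ->
  (forall s, a <= s <= b -> is_derive s 1 phi (dphi s)) ->
  (forall s, a < s < b -> dphi s <= 0) -> phi b <= phi a.
Proof.
rewrite le_eqVlt => /predU1P[->//|ab] phiE dphi0.
have [||c] := @MVT _ phi dphi a b ab.
- by move=> s /[!in_itv]/= /andP[sa sb]; apply: phiE; rewrite !ltW.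
- by apply: derivable_within_continuous => s /[!in_itv]/= /phiE[].
rewrite in_itv/= => cab phiba.
by rewrite -subr_le0 phiba mulr_le0_ge0 ?dphi0// subr_ge0 ltW.
Qed.

(** The last crossing time is the supremum of the times where [phi <= L];
    continuity puts this supremum itself in that set. *)
Lemma last_crossing {phi a b L} : a <= b ->
  (forall s, a <= s <= b -> {for s, continuous phi}) ->
  phi a <= L -> L < phi b ->
  exists2 s0, a <= s0 < b & phi s0 <= L /\ forall s, s0 < s <= b -> L < phi s.
Proof.
move=> ab cphi phia phib.
pose S := [set s | a <= s <= b /\ phi s <= L].
have Sa : S a by rewrite /S/= lexx ab.
have Sb : ubound S b by move=> s [/andP[]].
have supS : has_sup S by split; [exists a|exists b].
have aS : a <= sup S by apply: sup_upper_bound.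
have bS : sup S <= b by apply: ge_sup => //; exists a.
have phiS : phi (sup S) <= L.
  rewrite leNgt; apply/negP => Lphi.
  have /cphi/cvgrPdist_lt/(_ (phi (sup S) - L)) : a <= sup S <= b by rewrite aS.
  rewrite subr_gt0 => /(_ Lphi)/nbhs_ballP[e /= e0 he].
  have [s Ss es] := sup_adherent e0 supS.
  have sS : s <= sup S by exact: sup_upper_bound.
  have /he : ball (sup S) e s by rewrite /ball/= ger0_norm ?subr_ge0//; lra.
  move=> /(le_lt_trans (ler_norm _)); case: Ss => _; lra.
exists (sup S).
  rewrite aS lt_neqAle bS andbT; apply: contraTneq phib => <-.
  by rewrite -leNgt.
split=> // s /andP[Ss sb]; rewrite ltNge; apply/negP => sL.
have : s <= sup S by apply: sup_upper_bound => //; rewrite /S/= sb (le_trans aS (ltW Ss)).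
by rewrite leNgt Ss.
Qed.

Lemma is_derive_continuous {phi s d} : is_derive s 1 phi d -> {for s, continuous phi}.
Proof.
by move=> [/derivable1_diffP + _]; exact: differentiable_continuous.
Qed.

(** A barrier argument: a function which cannot increase while its value is in
    the band from [L] to [L + w] cannot leave the sublevel set of [L], since just
    after a last crossing of [L] it would have to increase inside the band. *)
Lemma sublevel_invariant phi dphi a b L (w : R) : a <= b -> 0 < w ->
  (forall s, a <= s <= b -> is_derive s 1 phi (dphi s)) ->
  (forall s, a <= s <= b -> L <= phi s <= L + w -> dphi s <= 0) ->
  phi a <= L -> phi b <= L.
Proof.
move=> ab w0 phiE dphi0 phia; rewrite leNgt; apply/negP => phib.
have cphi s : a <= s <= b -> {for s, continuous phi}.
  by move=> /phiE; exact: is_derive_continuous.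
have [s0 /andP[as0 s0b] [phis0 s0L]] := last_crossing ab cphi phia phib.
have /cphi/cvgrPdist_lt/(_ _ w0)/nbhs_ballP[e /= e0 he] : a <= s0 <= b.
  by rewrite as0 ltW.
(* Up to [s1], continuity at [s0] keeps [phi] below [L + w]. *)
pose s1 := Num.min b (s0 + e / 2).
have s01 : s0 < s1 by rewrite /s1 lt_min s0b ltrDl divr_gt0.
have s1b : s1 <= b by rewrite /s1 ge_min lexx.
have s1e : s1 <= s0 + e / 2 by rewrite /s1 ge_min lexx orbT.
have : phi s1 <= phi s0.
  apply: (@le0_is_derive_le _ dphi) => [|s /andP[s0s ss1]|s /andP[s0s ss1]].
  - exact: ltW.
  - by apply: phiE; lra.
  - have sb : s <= b by lra.
    have /he : ball s0 e s by rewrite /ball/= ltr0_norm ?subr_lt0//; lra.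
    rewrite ltr_norml => /andP[phis _].
    apply: dphi0; first lra.
    by rewrite ltW ?s0L ?s0s//=; lra.
by rewrite leNgt (le_lt_trans phis0)// s0L// s01.
Qed.

End Calculus.

(** * Curves in Euclidean space *)

Section VectorCalculus.
Context {R : realType} {n : nat}.
Implicit Types (x y : R -> 'rV[R]_n) (s t : R).

Lemma is_derive_coord {x s dx} i : is_derive s 1 x dx ->
  is_derive s 1 (fun t => x t 0 i) (dx 0 i).
Proof.
move=> dxP; apply: DeriveDef; first exact/(derivable_mxP x s 1).1/ex_derive.
by have := @derive_val _ _ _ _ _ _ _ dxP; rewrite derive_mx// => <-; rewrite mxE.
Qed.

Lemma is_derive_dotp {x s dx} : is_derive s 1 x dx ->
  is_derive s 1 (fun t => dotp (x t) (x t)) (2 * dotp dx (x s)).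
Proof.
move=> dxP.
have -> : (fun t => dotp (x t) (x t)) =
    \sum_(i < n) ((fun t => x t 0 i) * (fun t => x t 0 i)).
  by apply/funext => t; rewrite fct_sumE.
apply: is_derive_eq.
  by apply: is_derive_sum => i; apply: is_deriveM; exact: is_derive_coord.
rewrite mulr_sumr; apply: eq_bigr => i _.
by rewrite /GRing.scale/= mulr_natl mulr2n mulrC.
Qed.

Lemma is_derive_translate {x s c dx} : is_derive (s + c) 1 x dx ->
  is_derive s 1 (fun t => x (t + c)) dx.
Proof.
move=> [dx1 dx2]; suff E : (fun h : R => h^-1 *: (x (h *: 1 + s + c) - x (s + c))) =
    (fun h : R => h^-1 *: (x (h *: 1 + (s + c)) - x (s + c))).
  by apply: DeriveDef; rewrite /derivable /derive E.
by apply/funext => h; rewrite addrA.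
Qed.

End VectorCalculus.

(** * Gronwall's inequality *)

Lemma is_derive_expR_lin (R : realType) (c s : R) :
  is_derive s 1 (fun t => expR (c * t)) (c * expR (c * s)).
Proof.
rewrite mulrC; apply: (@is_derive1_comp _ expR (fun s => c * s)).
by rewrite -[c in X in is_derive _ _ _ X]mulr1; apply: is_deriveZ.
Qed.

(** The product of [phi] with the integrating factor [exp (- g s)] has nonpositive
    derivative. *)
Lemma gronwall (R : realType) (phi dphi : R -> R) (g t : R) : 0 <= t ->
  (forall s, 0 <= s <= t -> is_derive s 1 phi (dphi s)) ->
  (forall s, 0 <= s <= t -> dphi s <= g * phi s) ->
  phi t <= expR (g * t) * phi 0.
Proof.
move=> t0 phiE le_dphi.
have : expR (- g * t) * phi t <= expR (- g * 0) * phi 0.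
  pose dpsi s := expR (- g * s) * dphi s + phi s * (- g * expR (- g * s)).
  apply: (@le0_is_derive_le _ (fun s => expR (- g * s) * phi s) dpsi _ _ t0).
    move=> s st; apply: (@is_deriveM _ _ (fun s => expR (- g * s)) phi).
      exact: is_derive_expR_lin.
    exact: phiE.
  move=> s /andP[s0 st].
  have -> : dpsi s = expR (- g * s) * (dphi s - g * phi s) by rewrite /dpsi; ring.
  by rewrite pmulr_rle0 ?expR_gt0// subr_le0 le_dphi// !ltW.
rewrite mulr0 expR0 mul1r -(ler_pM2l (expR_gt0 (g * t))) mulrA -expRD.
by rewrite mulNr subrr expR0 mul1r.
Qed.

(** * Solutions in the trapping ball *)

Section Dynamics.
Context {R : realType} {n : nat}.
Variables (A : {linear 'rV[R]_n -> 'rV[R]_n}).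
Variables (B : {bilinear 'rV[R]_n -> 'rV[R]_n -> 'rV[R]_n}).
Variables (f : 'rV[R]_n) (r delta : R).
Hypotheses (r_gt0 : 0 < r) (delta_gt0 : 0 < delta).
Hypothesis trapping : forall v : 'rV[R]_n, r <= enorm v <= r + delta ->
  dotp (vfield A B f v) v <= 0.
Let F := vfield A B f.
Let G := op_norm A + 2 * bilin_norm B * r.

Lemma solution_is_derive {v t x} : 0 <= t -> solution_upto F v t x ->
  forall s, 0 <= s <= t -> is_derive s 1 x (F (x s)).
Proof.
move=> t0 [a [b [/andP[a0 _] /andP[_ tb] _ xF]]] s /andP[s0 st].
by apply: xF; rewrite (lt_le_trans a0)//= (le_lt_trans st).
Qed.

(** [<F x, x>] is half the derivative of the squared norm, so the trapping
    condition says that the squared norm cannot increase in the band from [r ^ 2]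
    to [(r + delta) ^ 2]. *)
Lemma solution_eball {v t x} : 0 <= t -> eball r v -> solution_upto F v t x ->
  forall s, 0 <= s <= t -> eball r (x s).
Proof.
move=> t0 vr xP s /andP[s0 st].
have x0 : x 0 = v by case: xP => a [b []].
have r_ge0 := ltW r_gt0.
rewrite /eball/= -(ler_pXn2r (n := 2)) ?nnegrE ?enorm_ge0// enorm_sqr.
pose w := (r + delta) ^+ 2 - r ^+ 2.
apply: (@sublevel_invariant _ (fun s => dotp (x s) (x s))
  (fun s => 2 * dotp (F (x s)) (x s)) 0 s _ w) => //.
- by rewrite subr_gt0 ltr_pXn2r ?nnegrE ?addr_ge0 ?ltrDl ?(ltW delta_gt0).
- move=> a /andP[a0 sa]; apply/is_derive_dotp/(solution_is_derive t0 xP).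
  by rewrite a0 (le_trans sa).
- move=> a _; rewrite /w -enorm_sqr addrC subrK.
  rewrite !ler_pXn2r ?nnegrE ?enorm_ge0 ?addr_ge0 ?(ltW delta_gt0)// => xa.
  by rewrite pmulr_rle0// trapping.
- by rewrite x0 -enorm_sqr ler_pXn2r ?nnegrE ?enorm_ge0.
Qed.

(** With [D = v - w], bilinearity gives
    [F v - F w = - A D - B (v, D) - B (D, w)]; each of the two quadratic terms
    costs [bilin_norm B * r] because [v] and [w] are in the ball. *)
Lemma vfield_one_sided_lipschitz v w : eball r v -> eball r w ->
  dotp (F v - F w) (v - w) <= G * dotp (v - w) (v - w).
Proof.
move=> vr wr; set D := v - w.
have -> : F v - F w = - A D - B v D - B D w.
  rewrite /F /vfield /D linearB linearBr linearBl.
  by rewrite [_ - A w](addrC) !opprD !opprK; apply/rowP => i; rewrite !mxE; ring.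
rewrite 2!dotpDl.
have le_norm L z : enorm z <= L * enorm D -> dotp (- z) D <= L * dotp D D.
  move=> zL; apply: le_trans (dotp_le_enorm _ _) _.
  rewrite -enorm_sqr expr2 mulrA ler_wpM2r ?enorm_ge0//.
  by rewrite -scaleN1r enormZ normrN1 mul1r.
have bn0 := bilin_norm_ge0 B.
rewrite /G mulrDl (_ : 2 * _ * r = bilin_norm B * r + bilin_norm B * r); last by ring.
rewrite (mulrDl (_ * r)) addrA. apply: lerD; last first.
  apply: le_norm; apply: le_trans (enorm_bilin_norm _ _ _) _.
  by rewrite -mulrA ler_wpM2l// mulrC ler_wpM2r ?enorm_ge0.
rewrite lerD//; first exact/le_norm/enorm_op_norm.
apply: le_norm; apply: le_trans (enorm_bilin_norm _ _ _) _.
by rewrite -mulrA ler_wpM2l// ler_wpM2r ?enorm_ge0.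
Qed.

(** Gronwall's inequality is applied to the squared distance, with rate [2 G]:
    unlike the distance, it is differentiable where the two curves meet. *)
Lemma solution_lipschitz v w t x y : 0 <= t -> eball r v -> eball r w ->
  solution_upto F v t x -> solution_upto F w t y ->
  enorm (x t - y t) <= expR (G * t) * enorm (v - w).
Proof.
move=> t0 vr wr xP yP.
have x0 : x 0 = v by case: xP => a [b []].
have y0 : y 0 = w by case: yP => a [b []].
pose D (s : R) : 'rV[R]_n := x s - y s.
have DE (s : R) : 0 <= s <= t -> is_derive s 1 D (F (x s) - F (y s)).
  move=> st; apply: is_deriveB.
    exact: (solution_is_derive t0 xP).
  exact: (solution_is_derive t0 yP).
rewrite -(ler_pXn2r (n := 2)) ?nnegrE ?mulr_ge0 ?enorm_ge0 ?expR_ge0//.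
rewrite exprMn !enorm_sqr -x0 -y0 -expRM_natl mulrA.
apply: (@gronwall _ (fun s => dotp (D s) (D s))
  (fun s => 2 * dotp (F (x s) - F (y s)) (D s))) => // s st.
  by apply: is_derive_dotp; exact: DE.
rewrite -mulrA ler_pM2l//; apply: vfield_one_sided_lipschitz.
  exact: (solution_eball t0 vr xP).
exact: (solution_eball t0 wr yP).
Qed.

Lemma solution_upto_shift {v t x} : solution_upto F v t x ->
  solution_upto F (x t) (- t) (fun s => x (s + t)).
Proof.
move=> [a [b [/andP[a0 b0] /andP[ta tb] x0 xF]]].
exists (a - t), (b - t); split.
- by rewrite subr_lt0 ta subr_gt0.
- by rewrite -[X in _ < X < _]add0r !ltrD2r a0.
- by rewrite add0r.
- move=> s sab; apply: is_derive_translate; apply: xF.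
  by move: sab; rewrite ltrBlDr ltrBrDr.
Qed.

(** As [flow] is a choice among the values of solutions, existence of a solution
    is what makes the chosen value meaningful. *)
Lemma flow_solution {v t} : (exists x, solution_upto F v t x) ->
  exists2 x, solution_upto F v t x & x t = flow F t v.
Proof.
move=> [x xP].
exact: (xgetPex 0 (ex_intro [set y | exists2 x, solution_upto F v t x & x t = y]
  _ (ex_intro2 _ _ x xP erefl))).
Qed.

(** The backward solution from [flow t v] chosen by [flow (- t)], read forward
    in time after a shift by [t], is a solution which ends at [flow t v]. *)
Lemma flow_back_solution {v t} : (exists x, solution_upto F v t x) ->
  exists2 x, solution_upto F (flow F (- t) (flow F t v)) t x & x t = flow F t v.
Proof.
move=> /flow_solution[x xP <-].
have [|y yP yt] := @flow_solution (x t) (- t).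
  by exists (fun s => x (s + t)); exact: (solution_upto_shift xP).
exists (fun s => y (s - t)); last by case: yP => a [b [_ _ y0 _]]; rewrite subrr y0.
by have := solution_upto_shift yP; rewrite opprK yt.
Qed.

End Dynamics.

(** * Diameters and supports *)

Section Diameter.
Context {R : realType} {n : nat}.

Lemma diam_le (S : set 'rV[R]_n) (M : R) : 0 <= M ->
  (forall v w, S v -> S w -> enorm (v - w) <= M) -> (diam S <= M%:E)%E.
Proof.
move=> M0 SM; rewrite /diam ge_max lee_fin M0/=.
by apply: ge_ereal_sup => _ [v [w [Sv Sw ->]]]; rewrite lee_fin SM.
Qed.

(** If the normalizing integral is 0 or infinite the quotient is 0 everywhere, so
    the inclusion holds for every weight [g]. *)
Lemma supp_normalize (g : 'rV[R]_n -> R) : supp (normalize g) `<=` supp g.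
Proof. by move=> v; rewrite /supp/= /normalize mulf_eq0 negb_or => /andP[]. Qed.

End Diameter.

(** * Identifiability and the observation sets *)

Section Observability.
Context {R : realType} {n m : nat}.
Variables (F : 'rV[R]_n -> 'rV[R]_n) (H : 'M[R]_(m, n)) (h r : R).
Variables (u : 'rV[R]_n) (k : nat) (c : R).
Hypothesis c_gt0 : 0 < c.
Hypothesis identif : forall v : 'rV[R]_n, eball r v ->
  c * enorm (v - u) <= \big[Num.max/0]_(i < k.+1)
    enorm (obs F H (i%:R * h) u - obs F H (i%:R * h) v).

Lemma obs_close_enorm_le e v : 0 <= e -> eball r v ->
  (forall i : 'I_k.+1,
     enorm (obs F H (i%:R * h) u - obs F H (i%:R * h) v) <= e) ->
  enorm (v - u) <= e / c.
Proof.
move=> e0 vr ve; rewrite ler_pdivlMr// mulrC (le_trans (identif _ vr))//.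
exact: bigmax_le.
Qed.

Lemma diam_Omega_le e : 0 <= e -> (diam (Omega F H h r k u e) <= (2 / c * e)%:E)%E.
Proof.
move=> e0.
have close v : Omega F H h r k u e v -> enorm (v - u) <= e / c.
  move=> [vr ve]; apply: obs_close_enorm_le => // i; rewrite enormB.
  by apply: le_trans ve; exact: (le_bigmax _ _ i).
apply: diam_le => [|v w /close vu /close wu].
  by rewrite mulr_ge0// divr_ge0// ltW.
by rewrite (le_trans (enorm_triangle v w u))// (_ : 2 / c * e = e / c + e / c);
  [exact: lerD|ring].
Qed.

Lemma Lambda_enorm_le (z : nat -> 'rV[R]_m) e v w :
  (forall i, enorm (z i) <= e) ->
  let y i := obs F H (i%:R * h) u + z i in
  Lambda F H h r k y e v -> Lambda F H h r k y e w ->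
  enorm (v - w) <= 2 * (2 / c) * e.
Proof.
move=> ze y yv yw.
have e0 : 0 <= e by exact: le_trans (enorm_ge0 _) (ze 0).
suff close a : Lambda F H h r k y e a -> enorm (a - u) <= (2 * e) / c.
  rewrite (le_trans (enorm_triangle v w u))//.
  by rewrite (_ : 2 * (2 / c) * e = (2 * e) / c + (2 * e) / c);
    [apply: lerD; exact: close|ring].
move=> [ar ya]; apply: obs_close_enorm_le => // [|i]; first by rewrite mulr_ge0.
have yi : enorm (y i - obs F H (i%:R * h) a) <= e.
  by apply: le_trans ya; exact: (le_bigmax _ _ i).
have -> : obs F H (i%:R * h) u - obs F H (i%:R * h) a =
    (y i - obs F H (i%:R * h) a) - z i.
  by rewrite /y [RHS]addrAC addrK.
rewrite (le_trans (enormD _ _))// mulr2n mulrDl mul1r lerD//.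
by rewrite -sub0r enormB subr0.
Qed.

End Observability.


(** * Diameters of the supports of the smoother and the filter *)

(* A lower bound |Phi(u) - Phi(v)| >= c |v - u| controls diameters by 1 / c:
   the bounds are stated with the constant C = 2 / c, as C * eps for Omega and
   2 * C * eps for Lambda. *)
Theorem theorem4p1 (R : realType) (d m : nat)
  (* dynamics *)
  (A : {linear 'rV[R]_d -> 'rV[R]_d})
  (B : {bilinear 'rV[R]_d -> 'rV[R]_d -> 'rV[R]_d})
  (f : 'rV[R]_d) (r delta : R)
  (r_gt0 : 0 < r) (delta_gt0 : 0 < delta)
  (trapping : forall v : 'rV[R]_d, r <= enorm v <= r + delta ->
     dotp (vfield A B f v) v <= 0)
  (global : forall (v : 'rV[R]_d) (t : R), eball r v -> 0 <= t ->
     exists x : R -> 'rV[R]_d, solution_upto (vfield A B f) v t x)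
  (* observations *)
  (h : R) (h_gt0 : 0 < h) (H : 'M[R]_(m, d))
  (dT : measure_display) (T : measurableType dT) (P : probability T R)
  (Z : nat -> T -> 'rV[R]_m) (eta : 'rV[R]_m -> R)
  (Z_rv : forall i, random_vector (Z i))
  (Z_indep : independent_vectors P Z)
  (eta_density : is_density eta)
  (Z_density : forall i, has_density P (Z i) eta)
  (Z_centered : forall i, centered P (Z i))
  (* prior *)
  (q : 'rV[R]_d -> R) (q_density : is_density q)
  (q_supp : forall v, ~ eball r v -> q v = 0)
  (* true initial point and identifiability *)
  (u : 'rV[R]_d) (u_ball : eball r u)
  (k : nat) (c : R) (c_gt0 : 0 < c)
  (identif : forall v : 'rV[R]_d, eball r v ->
     c * enorm (v - u) <=
     \big[Num.max/0]_(i < k.+1)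
       enorm (obs (vfield A B f) H (i%:R * h) u
              - obs (vfield A B f) H (i%:R * h) v)) :
  let F := vfield A B f in
  let Y := fun (w : T) (i : nat) => obs F H (i%:R * h) u + Z i w in
  let G := op_norm A + 2 * bilin_norm B * r in
  forall eps : R, 0 < eps ->
    (diam (Omega F H h r k u eps) <= (2 / c * eps)%:E)%E /\
    ((forall i, {ae P, forall w, enorm (Z i w) <= eps}) ->
     {ae P, forall w,
        (diam (Lambda F H h r k (Y w) eps) <= (2 * (2 / c) * eps)%:E)%E} /\
     (* a density is only determined up to null sets: for bounded errors it is
        taken to vanish outside the ball where the errors live *)
     ((forall z, eps < enorm z -> eta z = 0) ->
      {ae P, forall w,
        (diam (supp (smoother F H h r q eta k (Y w)))
           <= (2 * (2 / c) * eps)%:E)%E /\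
        (diam (supp (filter_density F H h r q eta k (Y w)))
           <= (2 * (2 / c) * expR (G * (k%:R * h)) * eps)%:E)%E})).

Proof.
move=> F Y G eps eps_gt0; have eps_ge0 := ltW eps_gt0.
split; first exact: diam_Omega_le.
move=> /ae_foralln Z_eps; have C_ge0 : 0 <= 2 * (2 / c) * eps.
  by rewrite !mulr_ge0// invr_ge0 ltW.
split.
  apply: filterS Z_eps => w Zw; apply: diam_le => // v v' vL v'L.
  exact: (Lambda_enorm_le _ _ _ _ _ _ _ c_gt0 identif (Z ^~ w)).
move=> eta0; apply: filterS Z_eps => w Zw.
(* A point with nonzero likelihood has residuals in the support of [eta]. *)
have in_Lambda v : eball r v ->
    \prod_(i < k.+1) eta (Y w i - obs F H (i%:R * h) v) != 0 ->
    Lambda F H h r k (Y w) eps v.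
  move=> vr /prodf_neq0 etaP; split=> //; apply: bigmax_le => // i _.
  by rewrite leNgt; apply/negP => /eta0/eqP; apply/negP/etaP.
split; apply: diam_le.
- by [].
- move=> v v' /supp_normalize + /supp_normalize; rewrite /supp/=.
  case: ifPn => [/set_mem vr|_]; last by rewrite eqxx.
  rewrite mulf_eq0 negb_or => /andP[_ /(in_Lambda _ vr) vL].
  case: ifPn => [/set_mem v'r|_]; last by rewrite eqxx.
  rewrite mulf_eq0 negb_or => /andP[_ /(in_Lambda _ v'r) v'L].
  exact: (Lambda_enorm_le _ _ _ _ _ _ _ c_gt0 identif (Z ^~ w)).
- by rewrite -mulrA mulrCA mulr_ge0 ?expR_ge0// mulrC.
have t_ge0 : 0 <= k%:R * h by rewrite mulr_ge0// ltW.
(* [back v] is in the ball because the prior is nonzero there. *)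
pose back := flow F (- (k%:R * h)).
have back_spec v : supp (filter_density F H h r q eta k (Y w)) v ->
    Lambda F H h r k (Y w) eps (back v) /\
    exists2 x, solution_upto F (back v) (k%:R * h) x & x (k%:R * h) = v.
  move=> /supp_normalize; rewrite /supp/=.
  case: ifPn => [/set_mem [v0 v0r <-]|_]; last by rewrite eqxx.
  rewrite !mulf_eq0 !negb_or => /andP[/andP[etaP _] qP].
  split; last exact/flow_back_solution/global.
  apply: in_Lambda => //; apply: contrapT => /q_supp q0.
  by rewrite q0 eqxx in qP.
move=> v v' /back_spec[vL [x xP <-]] /back_spec[v'L [y yP <-]].
apply: le_trans (solution_lipschitz _ _ _ _ _ r_gt0 delta_gt0 trapping _ _ _ _ _
  t_ge0 _ _ xP yP) _.
- by case: vL.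
- by case: v'L.
rewrite [leRHS]mulrAC [leRHS]mulrC ler_wpM2l ?expR_ge0//.
exact: (Lambda_enorm_le _ _ _ _ _ _ _ c_gt0 identif (Z ^~ w)).
Qed.
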